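(* Let $n\ge1$. The finite representation property holds for the signature $(\langle\ \rangle;,\mathsf A_1,\dots,\mathsf A_n,\mathsf F_1,\dots,\mathsf F_n)$ for representation by $n$-ary partial functions and for representation by injective $n$-ary partial functions. That is: every finite algebra of this signature that is representable by $n$-ary partial functions is isomorphic to an algebra of $n$-ary partial functions with a finite base; and every finite algebra of this signature that is representable by injective $n$-ary partial functions is isomorphic to an algebra of $n$-ary partial functions that has a finite base and all of whose elements are injective.
   Context: Fix $n\ge 1$; $i$ ranges over $\{1,\dots,n\}$. The signature has an $(n+1)$-ary operation (composition), written $\langle a_1,\dots,a_n\rangle ; b$ (also $\boldsymbol a; b$), and unary operations $\mathsf A_1,\dots,\mathsf A_n,\mathsf F_1,\dots,\mathsf F_n$. Algebras are nonempty. An $n$-ary partial function on a set $X$ is a set $f\subseteq X^{n+1}$ such that $(\boldsymbol x,y),(\boldsymbol x,z)\in f$ implies $y=z$ (where $\boldsymbol x\in X^n$); it is injective if $(\boldsymbol x,z),(\boldsymbol y,z)\in f$ implies $\boldsymbol x=\boldsymbol y$. An algebra of $n$-ary partial functions of this signature is an algebra whose elements are $n$-ary partial functions, for which there are a set $X$ (the base) and an equivalence relation $E$ on $X$ such that every tuple $(x_1,\dots,x_{n+1})$ in every element lies in $X^{n+1}$ and has pairwise $E$-equivalent entries, and whose operations are $\boldsymbol f; g=\{(\boldsymbol x,z)\in X^{n+1} : \exists \boldsymbol y\in X^n,\ (\boldsymbol x,y_i)\in f_i \text{ for each } i \text{ and } (\boldsymbol y,z)\in g\}$, $\mathsf A_i(f)=\{(\boldsymbol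 x,x_i)\in X^{n+1} : x_1,\dots,x_n \text{ all } E\text{-equivalent and there is no } y\in X \text{ with } (\boldsymbol x,y)\in f\}$, $\mathsf F_i(f)=\{(\boldsymbol x,x_i)\in X^{n+1} : (\boldsymbol x,x_i)\in f\}$ (fixset). An algebra is representable by (injective) $n$-ary partial functions if it is isomorphic to an algebra of $n$-ary partial functions of the same signature (all of whose elements are injective). *)

(* Defs.v *)
From mathcomp Require Import all_boot.
From mathcomp Require Import boolp classical_sets functions cardinality.
From Corelib Require Import RelationClasses.

Set Implicit Arguments.
Unset Strict Implicit.
Unset Printing Implicit Defensive.

Local Open Scope classical_set_scope.

Record algebra (n : nat) := Algebra {
  carrier :> Type;
  carrier_nonempty : inhabited carrier;
  alg_comp : n.-tuple carrier -> carrier -> carrier;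
  alg_antidom : 'I_n -> carrier -> carrier;
  alg_fixset : 'I_n -> carrier -> carrier
}.

Section PartialFunctions.
Variables (n : nat) (X : Type).

(* Subsets of X^(n+1), a tuple (x_1, ..., x_n, y) being encoded as the pair
   ((x_1, ..., x_n), y); Leibniz equality of such sets is extensional
   equality, by the axioms of boolp. *)
Definition nrel := set (n.-tuple X * X).

Implicit Types (f g : nrel) (fs : n.-tuple nrel) (E : X -> X -> Prop).

Definition partial_function f : Prop :=
  forall x y z, f (x, y) -> f (x, z) -> y = z.

Definition injective_pfun f : Prop :=
  forall x y z, f (x, z) -> f (y, z) -> x = y.

Definition pairwise_equiv E m (t : m.-tuple X) : Prop :=
  forall i j : 'I_m, E (tnth t i) (tnth t j).

Definition within_equiv E f : Prop :=
  forall x y, f (x, y) -> pairwise_equiv E [tuple of rcons x y].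

Definition pfun_comp fs g : nrel :=
  [set p | exists y : n.-tuple X,
     (forall i : 'I_n, tnth fs i (p.1, tnth y i)) /\ g (y, p.2)].

Definition pfun_antidom E (i : 'I_n) f : nrel :=
  [set p | p.2 = tnth p.1 i /\
           pairwise_equiv E p.1 /\ ~ (exists y, f (p.1, y))].

Definition pfun_fixset (i : 'I_n) f : nrel :=
  [set p | p.2 = tnth p.1 i /\ f (p.1, tnth p.1 i)].

End PartialFunctions.

Record pfun_algebra (n : nat) := PfunAlgebra {
  base : Type;
  base_equiv : base -> base -> Prop;
  elements : set (nrel n base);
  base_equivP : Equivalence base_equiv;
  elements_nonempty : elements !=set0;
  elements_pfun : forall f, elements f -> partial_function f;
  elements_within : forall f, elements f -> within_equiv base_equiv f;
  elements_comp : forall (fs : n.-tuple (nrel n base)) g,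
    (forall i, elements (tnth fs i)) -> elements g ->
    elements (pfun_comp fs g);
  elements_antidom : forall i f,
    elements f -> elements (pfun_antidom base_equiv i f);
  elements_fixset : forall i f, elements f -> elements (pfun_fixset i f)
}.

Arguments base_equiv {n} p _ _.
Arguments elements {n} p _.

Definition all_injective n (B : pfun_algebra n) : Prop :=
  forall f, elements B f -> injective_pfun f.

Definition isomorphic n (A : algebra n) (B : pfun_algebra n) : Prop :=
  exists h : A -> nrel n (base B),
    [/\ set_bij [set: A] (elements B) h,
        forall (a : n.-tuple A) (b : A),
          h (alg_comp a b) = pfun_comp (map_tuple h a) (h b),
        forall i (a : A),
          h (alg_antidom i a) = pfun_antidom (base_equiv B) i (h a)
      & forall i (a : A), h (alg_fixset i a) = pfun_fixset i (h a)].

Definition representable n (A : algebra n) : Prop :=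
  exists B : pfun_algebra n, isomorphic A B.

Definition injectively_representable n (A : algebra n) : Prop :=
  exists B : pfun_algebra n, all_injective B /\ isomorphic A B.

(* Main.v *)
Require Import Defs.
From mathcomp Require Import all_boot.
From mathcomp Require Import boolp classical_sets functions cardinality.

Local Open Scope classical_set_scope.

(** Let [B] be an algebra of n-ary partial functions with base [X].  The orbit
    of a tuple [x] is the set of the values [f x], for [f] in [B] defined at
    [x].  Orbits are closed under the elements of [B], because
    [g (f_1 x, ..., f_n x)] is the value at [x] of the composition of the
    [f_i] with [g]; and the orbit of [x] has at most as many points as [B] has
    elements.  Since an orbit is closed under values, restricting all elements
    of [B] to it respects composition, antidomain (a function undefined on a
    tuple of the orbit inside the orbit is undefined there in [X] too) and
    fixset; restriction also preserves injectivity.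

    So [B] maps onto the algebra of its restrictions to the disjoint union of
    the orbits of any set [S] of tuples, the equivalence relation being that of
    lying in the same summand.  If the entries of [x] are pairwise equivalent,
    as they are whenever some element is defined at [x], then they lie in the
    orbit of [x], since [B] contains the empty function and hence, as its
    antidomains, the projections on such tuples.  Therefore two elements of [B] that differ at some tuple of
    [S] keep distinct restrictions.  If [B] is finite, then finitely many
    tuples separate its elements, and the disjoint union of their orbits is a
    finite base on which [B] is faithfully represented. *)

Set Implicit Arguments.
Unset Strict Implicit.

(** For each of the finitely many pairs of members of [F], one first coordinate
    at which the two members differ suffices. *)
Lemma finite_separating_set (T U : Type) (F : set (set (T * U))) :
  finite_set F ->
  exists2 S : set T, finite_set S &
    forall f g, F f -> F g ->
      (forall x z, S x -> f (x, z) <-> g (x, z)) -> f = g.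
Proof.
move=> finF.
have sep (fg : set (T * U) * set (T * U)) : exists W : set T,
    finite_set W /\
    ((forall x z, W x -> fg.1 (x, z) <-> fg.2 (x, z)) -> fg.1 = fg.2).
  have [agree|/existsNP[x differ]] :=
      pselect (forall x z, fg.1 (x, z) <-> fg.2 (x, z)).
    exists set0; split=> // _; apply/seteqP.
    by split=> -[x z]; apply agree.
  exists [set x]; split; first exact: finite_set1.
  by move=> agree; case: differ => z; exact: agree.
have [W WP] := choice sep.
exists (\bigcup_(fg in F `*` F) W fg).
  apply: bigcup_finite; first exact: finite_setX.
  by move=> fg _; exact: (WP fg).1.
move=> f g Ff Fg agree; apply: (WP (f, g)).2 => x z Wx.
by apply: agree; exists (f, g).
Qed.

(** * Orbits of tuples *)

Section Orbits.
Variables (n : nat) (hn : (1 <= n)%N) (B : pfun_algebra n).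
Local Notation X := (base B).
Local Notation E := (base_equiv B).

Definition orbit (x : n.-tuple X) : set X :=
  [set z | exists2 f, elements B f & f (x, z)].

Lemma pfun_value_equiv f x z (i : 'I_n) :
  elements B f -> f (x, z) -> E (tnth x i) z.
Proof.
move=> Bf fxz.
have := elements_within Bf fxz (widen_ord (leqnSn n) i) ord_max.
rewrite !(tnth_nth z) /= !nth_rcons !size_tuple ltn_ord ltnn eqxx.
by rewrite -tnth_nth.
Qed.

Lemma pfun_arg_equiv f x z : elements B f -> f (x, z) -> pairwise_equiv E x.
Proof.
have [_ Esym Etrans] := base_equivP B.
move=> Bf fxz i j; apply: (Etrans _ z); first exact: pfun_value_equiv fxz.
by apply: Esym; exact: pfun_value_equiv fxz.
Qed.

Lemma orbit_equiv x y z : orbit x y -> orbit x z -> E y z.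
Proof.
have [_ Esym Etrans] := base_equivP B.
move=> [f Bf fxy] [g Bg gxz]; pose i := Ordinal hn.
apply: (Etrans _ (tnth x i)); last exact: pfun_value_equiv gxz.
by apply: Esym; exact: pfun_value_equiv fxy.
Qed.

(** The empty function is [f] precomposed with its own antidomains, and the
    antidomains of the empty function are the projections. *)
Lemma orbit_arg x (i : 'I_n) : pairwise_equiv E x -> orbit x (tnth x i).
Proof.
move=> Ex; have [f Bf] := elements_nonempty B.
pose zero := pfun_comp [tuple pfun_antidom E j f | j < n] f.
have Bzero : elements B zero.
  apply: elements_comp => // j; rewrite tnth_mktuple.
  exact: elements_antidom.
exists (pfun_antidom E i zero); first exact: elements_antidom.
split=> //; split=> //= -[z [y /= [projy fyz]]].
have yx : y = x.
  by apply: eq_from_tnth => j; have := projy j; rewrite tnth_mktuple => -[].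
have := projy i; rewrite tnth_mktuple => -[_ [_]]; apply.
by exists z; rewrite -yx.
Qed.

(** The value [g (f_1 x, ..., f_n x)] is the value at [x] of a composition. *)
Lemma orbit_closed x y z g :
  elements B g -> (forall i, orbit x (tnth y i)) -> g (y, z) -> orbit x z.
Proof.
move=> Bg orby gyz.
have /choice[f fP] i : exists f, elements B f /\ f (x, tnth y i).
  by have [f] := orby i; exists f.
exists (pfun_comp (mktuple f) g).
  by apply: elements_comp => // i; rewrite tnth_mktuple; exact: (fP i).1.
by exists y; split=> // i; rewrite tnth_mktuple; exact: (fP i).2.
Qed.

(** * Restriction to a disjoint union of orbits *)

Variable S : set (n.-tuple X).

(** The orbits of distinct tuples of [S] may overlap in [X]; the first component
    of a pair makes the union disjoint, naming the summand by its seed. *)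
Definition orbit_sum : set (n.-tuple X * X) :=
  [set p | S p.1 /\ orbit p.1 p.2].

Definition point : Type := orbit_sum.
Definition seed (u : point) : n.-tuple X := (set_val u).1.
Definition value (u : point) : X := (set_val u).2.
Definition same_seed (u v : point) : Prop := seed u = seed v.

Lemma value_orbit u : orbit (seed u) (value u).
Proof. by have [] := set_valP u. Qed.

Lemma point_inj u v : seed u = seed v -> value u = value v -> u = v.
Proof.
rewrite /seed /value !set_valE => suv vuv; apply: val_inj.
by rewrite [LHS]surjective_pairing [RHS]surjective_pairing suv vuv.
Qed.

Lemma point_of_orbit x z : S x -> orbit x z ->
  exists u, seed u = x /\ value u = z.
Proof.
move=> Sx xz; have pxz : orbit_sum (x, z) by [].
by exists (SigSub (mem_set pxz)); rewrite /seed /value set_valE.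
Qed.

Lemma seed_in u : S (seed u).
Proof. by have [] := set_valP u. Qed.

Lemma same_seed_equivP : RelationClasses.Equivalence same_seed.
Proof.
by split=> [u|u v uv|u v w uv vw]; [|exact: esym|exact: etrans vw].
Qed.

Definition restrict (f : nrel n X) : nrel n point :=
  [set p | (forall i, seed (tnth p.1 i) = seed p.2) /\
           f (map_tuple value p.1, value p.2)].

(** Inside one summand, a value taken in [X] is attained at a point of that
    summand. *)
Lemma lift_value f (s : n.-tuple point) x z :
  elements B f -> (forall i, seed (tnth s i) = x) ->
  f (map_tuple value s, z) -> exists u, seed u = x /\ value u = z.
Proof.
move=> Bf seeds fz; apply: point_of_orbit.
  by rewrite -(seeds (Ordinal hn)); exact: seed_in.
apply: orbit_closed Bf _ fz => i.
by rewrite tnth_map -(seeds i); exact: value_orbit.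
Qed.

(** The intermediate tuple of a composition consists of values at a tuple of
    the summand, so it lifts to that summand.  Conversely, all the points
    involved share one seed because [n] is positive: the intermediate tuple
    links the seed of the arguments to that of the value. *)
Lemma restrict_comp (fs : n.-tuple (nrel n X)) g :
  (forall i, elements B (tnth fs i)) ->
  restrict (pfun_comp fs g) = pfun_comp (map_tuple restrict fs) (restrict g).
Proof.
move=> Bfs; apply/seteqP; split=> -[s u] /=.
  move=> [seeds [y /= [fy gy]]].
  have /choice[t tP] i : exists v, seed v = seed u /\ value v = tnth y i.
    exact: lift_value (Bfs i) seeds (fy i).
  exists (mktuple t); split=> [i|] /=.
    rewrite tnth_map tnth_mktuple; have [st vt] := tP i.
    by split=> [j|] /=; rewrite ?st ?vt.
  split=> [i|] /=; first by rewrite tnth_mktuple; exact: (tP i).1.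
  suff -> : map_tuple value (mktuple t) = y by [].
  by apply: eq_from_tnth => i; rewrite tnth_map tnth_mktuple; exact: (tP i).2.
move=> [t [ft [seedt gt]]]; split=> [i|] /=.
  have := ft (Ordinal hn); rewrite tnth_map => -[/= -> _]; exact: seedt.
exists (map_tuple value t); split=> // i /=.
by have := ft i; rewrite !tnth_map => -[].
Qed.

(** A tuple with a common seed has pairwise equivalent values, as an orbit lies
    in one class of [E]; and a value at it in [X] would lift to the summand, so
    being undefined means the same before and after restriction. *)
Lemma restrict_antidom i f : elements B f ->
  restrict (pfun_antidom E i f) = pfun_antidom same_seed i (restrict f).
Proof.
move=> Bf; apply/seteqP; split=> -[s u] /=.
  move=> [/= seeds [/= vu [_ undef]]]; split=> /=.
    by apply: point_inj; rewrite ?seeds // vu tnth_map.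
  split=> [j k|[v [_ fv]]]; first by rewrite /same_seed !seeds.
  by apply: undef; exists (value v).
move=> [/= -> [seeds undef]]; split=> /=; first by move=> j; exact: seeds.
split=> /=; first by rewrite tnth_map.
split=> [j k|[z fz]].
  rewrite !tnth_map; apply: (@orbit_equiv (seed (tnth s i))).
    by rewrite (seeds i j); exact: value_orbit.
  by rewrite (seeds i k); exact: value_orbit.
have seedsi j : seed (tnth s j) = seed (tnth s i) by exact: seeds.
have [v [sv vz]] := lift_value Bf seedsi fz.
by apply: undef; exists v; split=> [j|] /=; rewrite ?sv ?vz.
Qed.

Lemma restrict_fixset i f :
  restrict (pfun_fixset i f) = pfun_fixset i (restrict f).
Proof.
apply/seteqP; split=> -[s u] /= [].
  move=> seeds [/= vu fu].
  have us : u = tnth s i by apply: point_inj; rewrite ?seeds // vu tnth_map.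
  by rewrite tnth_map in fu; split=> //=; split=> [j|] //=; rewrite -?us ?seeds.
move=> /= -> [/= seeds fs]; split=> //=.
by split=> /=; rewrite tnth_map.
Qed.

Lemma restrict_pfun f : partial_function f -> partial_function (restrict f).
Proof.
move=> pf s u v [/= su fu] [/= sv fv]; apply: point_inj; last exact: pf fu fv.
by rewrite -(su (Ordinal hn)) -(sv (Ordinal hn)).
Qed.

Lemma restrict_injective f : injective_pfun f -> injective_pfun (restrict f).
Proof.
move=> injf s t u [/= su fs] [/= tu ft]; apply: eq_from_tnth => i.
apply: point_inj; first by rewrite su tu.
have := congr1 (@tnth n X ^~ i) (injf _ _ _ fs ft).
by rewrite /= !tnth_map.
Qed.

Lemma restrict_within f : within_equiv same_seed (restrict f).
Proof.
move=> s u [/= su _].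
have seed_rcons (i : 'I_n.+1) : seed (tnth [tuple of rcons s u] i) = seed u.
  rewrite (tnth_nth u) /= nth_rcons size_tuple.
  case: ltnP => [ltin|_]; last by case: ifP.
  by rewrite -(su (Ordinal ltin)) (tnth_nth u).
by move=> i j; rewrite /same_seed !seed_rcons.
Qed.

Definition restrict_elements := restrict @` elements B.

Lemma restrict_elements_nonempty : restrict_elements !=set0.
Proof. by have [f Bf] := elements_nonempty B; exists (restrict f), f. Qed.

Lemma restrict_elements_pfun f : restrict_elements f -> partial_function f.
Proof. by move=> [g Bg <-]; apply: restrict_pfun; exact: elements_pfun. Qed.

Lemma restrict_elements_within f :
  restrict_elements f -> within_equiv same_seed f.
Proof. by move=> [g _ <-]; exact: restrict_within. Qed.

Lemma restrict_elements_comp (fs : n.-tuple (nrel n point)) g :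
  (forall i, restrict_elements (tnth fs i)) -> restrict_elements g ->
  restrict_elements (pfun_comp fs g).
Proof.
move=> Rfs [g' Bg' <-].
have /choice[h hP] i : exists h, elements B h /\ restrict h = tnth fs i.
  by have [h] := Rfs i; exists h.
have Bh i : elements B (tnth (mktuple h) i).
  by rewrite tnth_mktuple; exact: (hP i).1.
exists (pfun_comp (mktuple h) g'); first exact: elements_comp.
rewrite restrict_comp //; congr pfun_comp.
by apply: eq_from_tnth => i; rewrite tnth_map tnth_mktuple; exact: (hP i).2.
Qed.

Lemma restrict_elements_antidom i f :
  restrict_elements f -> restrict_elements (pfun_antidom same_seed i f).
Proof.
move=> [g Bg <-]; rewrite -restrict_antidom //.
by exists (pfun_antidom E i g) => //; exact: elements_antidom.
Qed.

Lemma restrict_elements_fixset i f :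
  restrict_elements f -> restrict_elements (pfun_fixset i f).
Proof.
move=> [g Bg <-]; rewrite -restrict_fixset.
by exists (pfun_fixset i g) => //; exact: elements_fixset.
Qed.

Definition restrict_algebra : pfun_algebra n :=
  PfunAlgebra same_seed_equivP restrict_elements_nonempty
    restrict_elements_pfun restrict_elements_within restrict_elements_comp
    restrict_elements_antidom restrict_elements_fixset.

Lemma restrict_algebra_injective :
  all_injective B -> all_injective restrict_algebra.
Proof. by move=> injB f [g Bg <-]; apply/restrict_injective/injB. Qed.

(** * Finiteness and faithfulness *)

(** A seed and an element determine at most one point. *)
Lemma finite_orbit_sum :
  finite_set S -> finite_set (elements B) -> finite_set [set: point].
Proof.
move=> finS finB; rewrite (eq_finite_set (card_setT _)).
pose value_at xf : set (n.-tuple X * X) := [set p | p.1 = xf.1 /\ xf.2 p].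
apply: (@sub_finite_set _ _ (\bigcup_(xf in S `*` elements B) value_at xf)).
  by move=> [x z] [Sx [f Bf fxz]]; exists (x, f).
apply: bigcup_finite; first exact: finite_setX.
move=> [x f] [/= _ Bf]; have [[z fxz]|undef] := pselect (exists z, f (x, z)).
  apply: (sub_finite_set _ (finite_set1 (x, z))) => -[_ z'] [/= -> fxz'] /=.
  by rewrite (elements_pfun Bf fxz fxz').
by apply: (sub_finite_set _ (@finite_set0 _)) => -[_ z] [/= -> fxz];
  case: undef; exists z.
Qed.

(** At a tuple [x] of [S], the restriction of [f] is read off at the copy of
    [x] in the summand of [x], which exists because [x] has its entries in its
    own orbit. *)
Lemma restrict_agree f g x z : elements B f -> restrict f = restrict g ->
  S x -> f (x, z) -> g (x, z).
Proof.
move=> Bf rfg Sx fxz.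
have [u [su vu]] : exists u, seed u = x /\ value u = z.
  by apply: point_of_orbit => //; exists f.
have /choice[s sP] i : exists v, seed v = x /\ value v = tnth x i.
  apply: point_of_orbit => //; apply: orbit_arg.
  exact: pfun_arg_equiv fxz.
have sx : map_tuple value (mktuple s) = x.
  by apply: eq_from_tnth => i; rewrite tnth_map tnth_mktuple; exact: (sP i).2.
have : restrict f (mktuple s, u).
  split=> [i|] /=; last by rewrite sx vu.
  by rewrite tnth_mktuple su; exact: (sP i).1.
by rewrite rfg => -[_] /=; rewrite sx vu.
Qed.

Lemma restrict_isomorphic (A : algebra n) :
  (forall f g, elements B f -> elements B g ->
    (forall x z, S x -> f (x, z) <-> g (x, z)) -> f = g) ->
  isomorphic A B -> isomorphic A restrict_algebra.
Proof.
move=> sep [h [[hB hinj hsurj] hcomp hantidom hfixset]].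
have Bh a : elements B (h a) by exact: hB.
exists (restrict \o h); split.
- split.
  + by move=> a _; exists (h a).
  + move=> a b _ _ /= rab; apply: hinj; rewrite ?inE //.
    by apply: sep => // x z Sx; split; exact: restrict_agree.
  + by move=> f [g Bg <-]; have [a _ <-] := hsurj _ Bg; exists a.
- move=> a b /=; rewrite hcomp restrict_comp => [|i]; last by rewrite tnth_map.
  by congr pfun_comp; apply: eq_from_tnth => i; rewrite !tnth_map.
- by move=> i a /=; rewrite hantidom restrict_antidom.
- by move=> i a /=; rewrite hfixset restrict_fixset.
Qed.

End Orbits.

(** One construction serves both representation notions, since it preserves
    injectivity. *)
Lemma finite_base_representation (n : nat) (hn : (1 <= n)%N) (A : algebra n)
    (B : pfun_algebra n) : finite_set [set: A] -> isomorphic A B ->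
  exists C : pfun_algebra n,
    [/\ finite_set [set: base C], all_injective B -> all_injective C
      & isomorphic A C].
Proof.
move=> finA isoAB.
have finB : finite_set (elements B).
  have [h [[_ _ hsurj] _ _ _]] := isoAB.
  exact: sub_finite_set (hsurj : elements B `<=` _) (finite_image _ finA).
have [S finS sep] := finite_separating_set finB.
exists (restrict_algebra hn S); split.
- exact: finite_orbit_sum.
- exact: restrict_algebra_injective.
- exact: restrict_isomorphic sep isoAB.
Qed.

Theorem corollary8p5 (n : nat) (hn : (1 <= n)%N) :
  (forall A : algebra n,
     finite_set [set: A] -> representable A ->
     exists B : pfun_algebra n,
       finite_set [set: base B] /\ isomorphic A B) /\
  (forall A : algebra n,
     finite_set [set: A] -> injectively_representable A ->
     exists B : pfun_algebra n,
       [/\ finite_set [set: base B], all_injective B & isomorphic A B]).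
Proof.
split=> A finA.
  move=> [B isoAB].
  have [C [finC _ isoAC]] := finite_base_representation hn finA isoAB.
  by exists C.
move=> [B [injB isoAB]].
have [C [finC injC isoAC]] := finite_base_representation hn finA isoAB.
by exists C; split=> //; exact: injC.
Qed.
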